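(* Let $X$ be a Fr\'echet space with a translation-invariant metric $d$ (i.e. $d(u,v)=d(u+w,v+w)$), let $\mathfrak F\subseteq\mathfrak S$, and let $\pi:X\to X$ be a continuous linear projection onto a finite-dimensional subspace $W=\pi(X)$. For $v\in X$ and $\varepsilon>0$ put $B^{\pi,v}(\varepsilon)=\{v+w:w\in W,\ d(0,w)\le\varepsilon\}$. Suppose: (i) $\mathbb D(\mathfrak F)$ is approximately controllable on $X$, i.e. $\overline{A_{\mathbb D(\mathfrak F)}(u,t)}=X$ for all $u\in X$, $t>0$; (ii) for every $v\in X$ and $\varepsilon,\varepsilon',t>0$ there exist $\tilde u\in X$, $\Phi^1,\dots,\Phi^k\in\mathfrak F$, times $s_1,\dots,s_k>0$ with $\sum_js_j\le t$, and continuous maps $g_j:B^{\pi,v}(\varepsilon)\to\mathcal P(\Phi^j)$ such that $\sup_{\tilde v\in B^{\pi,v}(\varepsilon)}d\big(\Phi^{k,g_k(\tilde v)}_{s_k}\cdots\Phi^{1,g_1(\tilde v)}_{s_1}\tilde u,\ \tilde v\big)<\varepsilon'$. Then for all $u,v\in X$ and $t,\varepsilon>0$ there exist $\Psi^1,\dots,\Psi^n\in\mathbb D(\mathfrak F)$ and $t_1,\dots,t_n>0$ with $t_1+\dots+t_n=t$ such that $\pi(\Psi^n_{t_n}\cdots\Psi^1_{t_1}u)=\pi(v)$ and $d(\Psi^n_{t_n}\cdots\Psi^1_{t_1}u,v)<\varepsilon$.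
   Context: $\dagger\notin X$ is an extra (explosive) point and $(Y,d_Y)$ an auxiliary metric space. For nonempty $Z\subseteq Y$, a one-parameter family of continuous local semigroups on $X$ parametrized by $Z$ is a map $(t,u,p)\mapsto\Phi^p_tu:[0,\infty)\times X\times Z\to X\cup\{\dagger\}$ such that for every $u\in X$, $p\in Z$ there is $T_{u,p}>0$ with: (i) $\Phi^p_tu\in X$ for $t<T_{u,p}$ and $=\dagger$ for $t\ge T_{u,p}$; (ii) $\Phi^p_0u=u$ and for $s,t\ge0$ with $s+t<T_{u,p}$, $t<T_{\Phi^p_su,p}$ and $\Phi^p_{t+s}u=\Phi^p_t\Phi^p_su$; (iii) for every $t<T_{u,p}$, $\varepsilon>0$ there is $\delta>0$ such that $|t-t'|+d(u,u')+d_Y(p,p')<\delta$ implies $t'<T_{u',p'}$ and $d(\Phi^p_tu,\Phi^{p'}_{t'}u')<\varepsilon$. $\mathfrak S$ is the set of all such families, $\mathcal P(\Phi)$ the parameter set of $\Phi$, and for $\mathfrak F\subseteq\mathfrak S$, $\mathbb D(\mathfrak F)=\{\Phi^p:\Phi\in\mathfrak F,\ p\in\mathcal P(\Phi)\}$, where $\Phi^p$ is the continuous local semigroup $(t,u)\mapsto\Phi^p_tu$. Compositions are only considered when all partial compositions lie in $X$. For a set $\mathcal F$ of continuous local semigroups, $A_{\mathcal F}(u,t)=\{\Phi^n_{t_n}\cdots\Phi^1_{t_1}u:\Phi^j\in\mathcal F,t_j>0,\sum t_j=t\}$. *)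

(* Defs.v *)
From Stdlib Require Import Reals List.
Open Scope R_scope.
Set Implicit Arguments.

Record VecSpace := mkVecSpace {
  vcar :> Type;
  vadd : vcar -> vcar -> vcar;
  vzero : vcar;
  vopp : vcar -> vcar;
  vscal : R -> vcar -> vcar;
  vaddA : forall x y z, vadd x (vadd y z) = vadd (vadd x y) z;
  vaddC : forall x y, vadd x y = vadd y x;
  vadd0 : forall x, vadd vzero x = x;
  vaddN : forall x, vadd (vopp x) x = vzero;
  vscalA : forall a b x, vscal a (vscal b x) = vscal (a * b) x;
  vscal1 : forall x, vscal 1 x = x;
  vscalDr : forall a x y, vscal a (vadd x y) = vadd (vscal a x) (vscal a y);
  vscalDl : forall a b x, vscal (a + b) x = vadd (vscal a x) (vscal b x)
}.

Section Metric.
Variable T : Type.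
Variable dist : T -> T -> R.
Definition is_metric : Prop :=
  (forall x y, 0 <= dist x y) /\
  (forall x y, dist x y = 0 <-> x = y) /\
  (forall x y, dist x y = dist y x) /\
  (forall x y z, dist x z <= dist x y + dist y z).
End Metric.

Section Frechet.
Variable X : VecSpace.
Variable d : X -> X -> R.

Definition convex_set (C : X -> Prop) : Prop :=
  forall x y l, C x -> C y -> 0 <= l <= 1 ->
    C (vadd X (vscal X l x) (vscal X (1 - l) y)).

Definition frechet_metric : Prop :=
  is_metric d /\
  (forall x y eps, 0 < eps -> exists delta, 0 < delta /\
     forall x' y', d x x' < delta -> d y y' < delta ->
       d (vadd X x y) (vadd X x' y') < eps) /\
  (forall a x eps, 0 < eps -> exists delta, 0 < delta /\
     forall a' x', Rabs (a - a') < delta -> d x x' < delta ->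
       d (vscal X a x) (vscal X a' x') < eps) /\
  (forall u : nat -> X,
     (forall eps, 0 < eps -> exists N, forall m n, (N <= m)%nat -> (N <= n)%nat ->
        d (u m) (u n) < eps) ->
     exists l, forall eps, 0 < eps -> exists N, forall n, (N <= n)%nat -> d (u n) l < eps) /\
  (forall eps, 0 < eps -> exists C : X -> Prop, convex_set C /\
     (exists delta, 0 < delta /\ forall x, d (vzero X) x < delta -> C x) /\
     (forall x, C x -> d (vzero X) x < eps)).

Definition translation_invariant : Prop :=
  forall u v w, d u v = d (vadd X u w) (vadd X v w).

Fixpoint lincomb (n : nat) (c : nat -> R) (e : nat -> X) : X :=
  match n with
  | O => vzero X
  | S m => vadd X (lincomb m c e) (vscal X (c m) (e m))
  end.

Definition cont_lin_proj_findim (pi : X -> X) : Prop :=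
  (forall x y, pi (vadd X x y) = vadd X (pi x) (pi y)) /\
  (forall a x, pi (vscal X a x) = vscal X a (pi x)) /\
  (forall x eps, 0 < eps -> exists delta, 0 < delta /\
     forall y, d x y < delta -> d (pi x) (pi y) < eps) /\
  (forall x, pi (pi x) = pi x) /\
  (exists (n : nat) (e : nat -> X), forall x, exists c : nat -> R, pi x = lincomb n c e).

Definition Bpi (pi : X -> X) (v : X) (eps : R) (x : X) : Prop :=
  exists w, (exists y, w = pi y) /\ d (vzero X) w <= eps /\ x = vadd X v w.

Section Families.
Variable Y : Type.
Variable dY : Y -> Y -> R.

(* None plays the role of the explosive point dagger. *)
Definition lt_opt (t : R) (T : option R) : Prop :=
  match T with Some T0 => t < T0 | None => True end.

Definition is_lsfam (P : Y -> Prop) (phi : R -> X -> Y -> option X) : Prop :=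
  (exists p, P p) /\
  forall u p, P p ->
    (exists T : option R,
        (match T with Some T0 => 0 < T0 | None => True end) /\
        forall t, 0 <= t -> (phi t u p <> None <-> lt_opt t T)) /\
    phi 0 u p = Some u /\
    (forall s t, 0 <= s -> 0 <= t -> phi (s + t) u p <> None ->
       exists w, phi s u p = Some w /\ phi t w p <> None /\
                 phi (t + s) u p = phi t w p) /\
    (forall t w, 0 <= t -> phi t u p = Some w ->
       forall eps, 0 < eps -> exists delta, 0 < delta /\
         forall t' u' p', 0 <= t' -> P p' ->
           Rabs (t - t') + d u u' + dY p p' < delta ->
           exists w', phi t' u' p' = Some w' /\ d w w' < eps).

Record LSFamily := mkLSFamily {
  lsP : Y -> Prop;
  lsphi : R -> X -> Y -> option X;
  lsH : is_lsfam lsP lsphi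
}.

Definition LSG := R -> X -> option X.

Definition inD (F : LSFamily -> Prop) (Psi : LSG) : Prop :=
  exists (Phi : LSFamily) (p : Y), F Phi /\ lsP Phi p /\
    Psi = (fun t u => lsphi Phi t u p).

Fixpoint lsg_comp (l : list (LSG * R)) (x : X) : option X :=
  match l with
  | nil => Some x
  | (Psi, t) :: l' =>
      match Psi t x with Some y => lsg_comp l' y | None => None end
  end.

Definition sum_times {A : Type} (l : list (A * R)) : R :=
  fold_right (fun a s => snd a + s) 0 l.

Definition A_DF (F : LSFamily -> Prop) (u : X) (t : R) (w : X) : Prop :=
  exists l : list (LSG * R),
    Forall (fun a => inD F (fst a) /\ 0 < snd a) l /\
    sum_times l = t /\ lsg_comp l u = Some w.

Definition approx_controllable (F : LSFamily -> Prop) : Prop :=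
  forall u t, 0 < t -> forall x eps, 0 < eps ->
    exists w, A_DF F u t w /\ d w x < eps.

Definition cont_on (B : X -> Prop) (g : X -> Y) : Prop :=
  forall x, B x -> forall eps, 0 < eps -> exists delta, 0 < delta /\
    forall x', B x' -> d x x' < delta -> dY (g x) (g x') < eps.

Definition inst (l : list ((LSFamily * (X -> Y)) * R)) (vt : X) : list (LSG * R) :=
  map (fun a => ((fun t x => lsphi (fst (fst a)) t x (snd (fst a) vt)), snd a)) l.

End Families.
End Frechet.

(* Main.v *)
(** By Poincare-Miranda, a continuous map of a compact cube of W that moves every
    point by less than the inradius takes the value at the centre.  Steering [ut]
    to the points v + w (w in a small cube of W) as in (ii) has this property after
    projection by [pi]; it persists, uniformly over the cube, when [ut] is replaced
    by a nearby point, and such a point is reached from [u] in the remaining time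
    by (i).

    Poincare-Miranda itself is obtained from cochains mod 2: if [A_j] is a 0/1
    labelling of the grid cube that is 0 on the j-th lower face and 1 on the j-th upper face,
    the cup product of the coboundaries of the [A_j] is exact up to boundary terms,
    so by Stokes and induction on the dimension it sums to 1, and some small simplex
    carries both labels of every [A_j]. *)

Require Import Defs.
From Stdlib Require Import Reals List Bool Arith Lia Lra Classical ClassicalEpsilon.
Open Scope R_scope.

(** * A cubical Sperner lemma *)

Local Infix "(+)" := xorb (at level 50, left associativity).

Notation point := (list nat).
Notation chain := (list point).

(* Cochains mod 2 are functions [g : chain -> bool].  [bd g c] is [g] summed over the
   faces of [c], the empty face of a vertex included; [prism a b g c] is [g] summed over
   the triangulated prism [c] x [a,b]. *)
Fixpoint bd (g : chain -> bool) (c : chain) : bool :=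
  match c with
  | nil => false
  | y :: c' => g c' (+) bd (fun s => g (y :: s)) c'
  end.

Fixpoint prism (a b : nat) (g : chain -> bool) (c : chain) : bool :=
  match c with
  | nil => false
  | y :: c' => g ((a :: y) :: (b :: y) :: map (cons b) c')
               (+) prism a b (fun s => g ((a :: y) :: s)) c'
  end.

Lemma bd_xor (c : chain) : forall g h : chain -> bool,
  bd (fun s => g s (+) h s) c = bd g c (+) bd h c.
Proof.
  induction c as [|y c IH]; intros g h; simpl; auto.
  rewrite (IH (fun s => g (y :: s)) (fun s => h (y :: s))).
  destruct (g c), (h c), (bd (fun s => g (y :: s)) c), (bd (fun s => h (y :: s)) c); reflexivity.
Qed.

Lemma bd_false (c : chain) : bd (fun _ => false) c = false.
Proof. induction c as [|y c IH]; simpl; auto. Qed.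

Lemma bd_andb (b : bool) (g : chain -> bool) (c : chain) :
  bd (fun s => b && g s) c = b && bd g c.
Proof. destruct b; simpl; auto using bd_false. Qed.

Lemma bd_map (f : point -> point) (c : chain) : forall g : chain -> bool,
  bd g (map f c) = bd (fun s => g (map f s)) c.
Proof.
  induction c as [|y c IH]; intros g; simpl; auto.
  rewrite (IH (fun s => g (f y :: s))). reflexivity.
Qed.

(** Simplices of the prism over [c] have one more vertex than [c], all taken from its two copies.
    [P] carries the location of the vertices through the induction: a unit cell in one use, a face
    in another. *)
Lemma prism_ext (a b : nat) (P : point -> Prop) (c : chain) :
  forall g h : chain -> bool,
  Forall (fun y => P (a :: y) /\ P (b :: y)) c ->
  (forall s, length s = S (length c) -> Forall P s -> g s = h s) ->
  prism a b g c = prism a b h c.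
Proof.
  induction c as [|y c IH]; intros g h Hc H; simpl; auto.
  inversion Hc as [|y' c' [Ha Hb] Hc']; subst.
  f_equal.
  - apply H.
    + simpl. now rewrite length_map.
    + constructor; auto. constructor; auto.
      apply Forall_map. eapply Forall_impl; [|exact Hc']. simpl. tauto.
  - apply IH; auto. intros s Hs HP. apply H; auto. simpl. lia.
Qed.

Lemma prism_false (a b : nat) (c : chain) : prism a b (fun _ => false) c = false.
Proof. induction c as [|y c IH]; simpl; auto. Qed.

Lemma prism_xor (a b : nat) (c : chain) : forall g h : chain -> bool,
  prism a b (fun s => g s (+) h s) c = prism a b g c (+) prism a b h c.
Proof.
  induction c as [|y c IH]; intros g h; simpl; auto.
  rewrite (IH (fun s => g ((a :: y) :: s)) (fun s => h ((a :: y) :: s))).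
  destruct (g ((a :: y) :: (b :: y) :: map (cons b) c)),
    (h ((a :: y) :: (b :: y) :: map (cons b) c)),
    (prism a b (fun s => g ((a :: y) :: s)) c),
    (prism a b (fun s => h ((a :: y) :: s)) c); reflexivity.
Qed.

(** Chain homotopy mod 2: a prism is bounded by its two ends and the prism over the boundary of [c];
    walls shared by two of its simplices cancel. *)
Lemma prism_bd (a b : nat) (c : chain) : forall g : chain -> bool,
  prism a b (bd g) c =
  bd (prism a b g) c (+) (g (map (cons a) c) (+) g (map (cons b) c)).
Proof.
  induction c as [|y c IH]; intros g; simpl.
  - now destruct (g nil).
  - rewrite bd_map.
    rewrite (prism_xor a b c g (bd (fun s => g ((a :: y) :: s)))).
    rewrite (bd_xor c (fun s => g ((a :: y) :: (b :: y) :: map (cons b) s))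
                      (prism a b (fun s => g ((a :: y) :: s)))).
    rewrite IH.
    repeat match goal with |- context [bd ?h c] => destruct (bd h c) end;
    destruct (g ((b :: y) :: map (cons b) c)), (g ((a :: y) :: map (cons b) c)),
      (g ((a :: y) :: map (cons a) c)), (prism a b g c); reflexivity.
Qed.

Fixpoint xsum (n : nat) (f : nat -> bool) : bool :=
  match n with
  | O => false
  | S k => xsum k f (+) f k
  end.

Lemma xsum_ext (n : nat) (f h : nat -> bool) :
  (forall k, (k < n)%nat -> f k = h k) -> xsum n f = xsum n h.
Proof.
  induction n as [|n IH]; intros H; simpl; auto.
  rewrite IH, H; auto.
Qed.

Lemma xsum_false (n : nat) : xsum n (fun _ => false) = false.
Proof. induction n as [|n IH]; simpl; auto. now rewrite IH. Qed.

Definition layers (N : nat) (g : chain -> bool) (c : chain) : bool :=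
  xsum N (fun a => prism a (S a) g c).

(** The sum telescopes: the top of each layer is the bottom of the next, so only the levels 0 and
    [N] survive. *)
Lemma layers_bd (N : nat) (g : chain -> bool) (c : chain) :
  layers N (bd g) c =
  bd (layers N g) c (+) (g (map (cons O) c) (+) g (map (cons N) c)).
Proof.
  unfold layers. induction N as [|N IH]; simpl.
  - rewrite bd_false. now destruct (g (map (cons O) c)).
  - rewrite IH, prism_bd.
    rewrite (bd_xor c (fun s => xsum N (fun a => prism a (S a) g s)) (prism N (S N) g)).
    repeat match goal with |- context [bd ?h c] => destruct (bd h c) end;
    destruct (g (map (cons O) c)), (g (map (cons N) c)), (g (map (cons (S N)) c)); reflexivity.
Qed.

(** [cube_sum N n g] sums [g] over the maximal chains of the triangulation
    of the grid cube {0,...,N}^n obtained by iterating the prism construction. *)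
Fixpoint cube_sum (N n : nat) (g : chain -> bool) : bool :=
  match n with
  | O => g (nil :: nil)
  | S k => cube_sum N k (layers N g)
  end.

Definition near_corner (z y : point) : Prop :=
  Forall2 (fun a b => (a <= b <= S a)%nat) z y.

Definition small_chain (N n : nat) (c : chain) : Prop :=
  length c = S n /\
  exists z, length z = n /\ Forall (fun a => (a < N)%nat) z /\ Forall (near_corner z) c.

(** Every simplex of the triangulation sits in a single unit cell, with lowest corner [z]; this is
    what turns a nonzero sum into a small cell. *)
Lemma cube_sum_ext (N n : nat) : forall g h : chain -> bool,
  (forall c, small_chain N n c -> g c = h c) -> cube_sum N n g = cube_sum N n h.
Proof.
  induction n as [|n IH]; intros g h H; simpl.
  - apply H. split; auto. exists nil. repeat constructor.
  - apply IH. intros c [Hl [z [Hz [HN Hc]]]].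
    apply xsum_ext. intros a Ha.
    apply prism_ext with (P := near_corner (a :: z)).
    + eapply Forall_impl; [|exact Hc]. intros y Hy.
      split; constructor; auto; lia.
    + intros s Hs HP. apply H. split; [lia|].
      exists (a :: z). repeat split; auto. simpl; lia.
Qed.

Lemma layers_false (N : nat) (c : chain) : layers N (fun _ => false) c = false.
Proof.
  unfold layers. induction N as [|N IH]; simpl; auto.
  now rewrite IH, prism_false.
Qed.

Lemma layers_xor (N : nat) (g h : chain -> bool) (c : chain) :
  layers N (fun s => g s (+) h s) c = layers N g c (+) layers N h c.
Proof.
  unfold layers. induction N as [|N IH]; simpl; auto.
  rewrite IH, prism_xor.
  destruct (xsum N (fun a => prism a (S a) g c)), (xsum N (fun a => prism a (S a) h c)),
    (prism N (S N) g c), (prism N (S N) h c); reflexivity.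
Qed.

Lemma cube_sum_false (N n : nat) : cube_sum N n (fun _ => false) = false.
Proof.
  induction n as [|n IH]; simpl; auto.
  transitivity (cube_sum N n (fun _ => false)); auto.
  apply cube_sum_ext. intros c _. apply layers_false.
Qed.

Lemma cube_sum_xor (N n : nat) : forall g h : chain -> bool,
  cube_sum N n (fun s => g s (+) h s) = cube_sum N n g (+) cube_sum N n h.
Proof.
  induction n as [|n IH]; intros g h; simpl; auto.
  rewrite <- IH. apply cube_sum_ext. intros c _. apply layers_xor.
Qed.

Definition in_face (N j : nat) (c : chain) : Prop :=
  exists b, (b = O \/ b = N) /\ Forall (fun y => nth j y O = b) c.

Lemma layers_in_face (N j : nat) (g : chain -> bool) (c : chain) :
  (forall s, in_face N (S j) s -> g s = false) ->
  in_face N j c -> layers N g c = false.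
Proof.
  intros H [b [Hb Hc]].
  transitivity (layers N (fun _ => false) c); [|apply layers_false].
  apply xsum_ext. intros a _.
  apply prism_ext with (P := fun y => nth (S j) y O = b).
  - eapply Forall_impl; [|exact Hc]. simpl; auto.
  - intros s _ Hs. apply H. exists b. split; auto.
Qed.

(** Stokes' formula mod 2: inner faces cancel. *)
Lemma cube_sum_bd (N n : nat) : forall g : chain -> bool,
  g nil = false -> (forall j c, (j < n)%nat -> in_face N j c -> g c = false) ->
  cube_sum N n (bd g) = false.
Proof.
  induction n as [|n IH]; intros g H0 H; simpl.
  (* The 0-cube is a single vertex, whose only face is the empty chain. *)
  - now rewrite H0.
  - assert (Hf : forall b, (b = O \/ b = N) -> forall c, g (map (cons b) c) = false).
    { intros b Hb c. apply (H O); [lia|]. exists b. split; auto.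
      apply Forall_map. apply Forall_forall. reflexivity. }
    (* Both end terms are values of [g] on faces of the first coordinate and vanish; a boundary in
       one dimension less remains. *)
    rewrite (cube_sum_ext N n (layers N (bd g)) (bd (layers N g))).
    + apply IH.
      * apply xsum_false.
      * intros j c Hj. apply layers_in_face. intros s. apply H. lia.
    + intros c _. rewrite layers_bd, !Hf by auto. now destruct (bd (layers N g) c).
Qed.

(** The cup product of the coboundaries of the 0-cochains in [As]. *)
Fixpoint cup (As : list (point -> bool)) (c : chain) {struct As} : bool :=
  match As with
  | nil => true
  | A :: As' =>
      match c with
      | x :: ((y :: _) as c') => (A x (+) A y) && cup As' c'
      | _ => false
      end
  end.

Lemma bd_cup (As : list (point -> bool)) : forall c,
  length c = S (S (length As)) -> bd (cup As) c = false.
Proof.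
  induction As as [|A As IH]; intros c Hc.
  - destruct c as [|x [|y [|z c]]]; try discriminate. reflexivity.
  - destruct c as [|x [|y [|z c]]]; try discriminate.
    assert (Hl : length (y :: z :: c) = S (S (length As))) by (simpl in Hc |- *; lia).
    specialize (IH _ Hl).
    (* The faces omitting [x] and [y] carry the factors [A y (+) A z] and [A x (+) A z] on the same
       chain. These add up to [A x (+) A y], the factor of all other faces, so the total is that
       factor times [bd (cup As)], which is 0 by induction. *)
    change (cup (A :: As) (y :: z :: c) (+) (cup (A :: As) (x :: z :: c)
              (+) bd (fun s => (A x (+) A y) && cup As (y :: s)) (z :: c)) = false).
    rewrite bd_andb. cbn [bd cup] in IH |- *.
    destruct (A x), (A y), (A z), (cup As (z :: c)), (cup As (y :: c)),
      (bd (fun s => cup As (y :: z :: s)) c); simpl in *; congruence.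
Qed.

Definition cup0 (A : point -> bool) (As : list (point -> bool)) (c : chain) : bool :=
  match c with
  | nil => false
  | x :: _ => A x && cup As c
  end.

(** Leibniz rule: [cup0 A As] is the 0-cochain [A] times the cocycle [cup As], so only the
    coboundary of [A] contributes. *)
Lemma bd_cup0 (A : point -> bool) (As : list (point -> bool)) (c : chain) :
  length c = S (S (length As)) -> bd (cup0 A As) c = cup (A :: As) c.
Proof.
  intros Hc. pose proof (bd_cup As c Hc) as H.
  destruct c as [|x [|y c]]; try discriminate.
  cbn [bd] in H.
  change (bd (cup0 A As) (x :: y :: c)) with
    (A y && cup As (y :: c) (+) bd (fun s => A x && cup As (x :: s)) (y :: c)).
  rewrite bd_andb. cbn [bd cup].
  destruct (A x), (A y), (cup As (y :: c)), (cup As (x :: c)),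
    (bd (fun s => cup As (x :: y :: s)) c); simpl in *; congruence.
Qed.

Lemma cup_const (As : list (point -> bool)) (A : point -> bool) (b : bool) :
  In A As -> forall c, Forall (fun y => A y = b) c -> cup As c = false.
Proof.
  induction As as [|A' As IH]; intros HA c Hc; [destruct HA|].
  destruct c as [|x [|y c]]; auto.
  inversion Hc as [|? ? Hx Hc']; subst. inversion Hc' as [|? ? Hy Hc'']; subst.
  destruct HA as [-> | HA]; simpl.
  - rewrite Hy. now destruct (A x).
  - fold (cup As (y :: c)). rewrite (IH HA (y :: c) Hc'). apply andb_false_r.
Qed.

Lemma cup_map (f : point -> point) (As : list (point -> bool)) : forall c,
  cup As (map f c) = cup (map (fun A y => A (f y)) As) c.
Proof.
  induction As as [|A As IH]; intros c; auto.
  destruct c as [|x [|y c]]; auto.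
  cbn [map cup]. f_equal. apply (IH (y :: c)).
Qed.

Definition separates (N j : nat) (A : point -> bool) : Prop :=
  (forall y, nth j y O = O -> A y = false) /\ (forall y, nth j y O = N -> A y = true).

(** The product is the coboundary of [cup0 A As], so by Stokes only faces count. Faces in later
    directions contribute 0, and so does the bottom, where [A] is 0. On the top [A] is 1, leaving
    the same sum for the remaining labellings, one dimension lower. *)
Lemma cube_sum_cup (N : nat) : forall As : list (point -> bool),
  (forall j, (j < length As)%nat -> separates N j (nth j As (fun _ => false))) ->
  cube_sum N (length As) (cup As) = true.
Proof.
  intros As. remember (length As) as n eqn:Hn. revert As Hn.
  induction n as [|n IH]; intros As Hn H.
  - destruct As; [reflexivity | discriminate].
  - destruct As as [|A As]; [discriminate|]. simpl in Hn. injection Hn as Hn.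
    destruct (H O) as [H0 HN]; [lia|]. simpl in H0, HN.
    rewrite (cube_sum_ext N (S n) (cup (A :: As)) (bd (cup0 A As))).
    2:{ intros c [Hl _]. symmetry. apply bd_cup0. lia. }
    cbn [cube_sum].
    rewrite (cube_sum_ext N n (layers N (bd (cup0 A As)))
       (fun c => bd (layers N (cup0 A As)) c (+) cup (map (fun A y => A (N :: y)) As) c)).
    2:{ intros c [Hl _]. rewrite layers_bd. f_equal.
        destruct c as [|x c]; [discriminate|].
        rewrite <- cup_map. simpl map. cbn [cup0].
        rewrite H0, HN by reflexivity. now rewrite andb_true_l. }
    rewrite cube_sum_xor, cube_sum_bd, IH; auto.
    + now rewrite length_map.
    + intros j Hj. destruct (H (S j)) as [Hj0 HjN]; [lia|]. simpl in Hj0, HjN.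
      (* The default [fun _ => false] is its own restriction up to conversion, so [map_nth]
         applies. *)
      rewrite (map_nth (fun (A : point -> bool) y => A (N :: y)) As (fun _ => false) j
               : nth j (map _ As) (fun _ => false) = _).
      split; intros y Hy; [apply Hj0 | apply HjN]; exact Hy.
    + apply xsum_false.
    + intros j c Hj. apply layers_in_face.
      intros [|x s] [b [Hb Hs]]; auto. cbn [cup0].
      destruct (H (S j)) as [Hj0 HjN]; [lia|]. simpl in Hj0, HjN.
      (* On a face of a later direction the labelling of that direction is constant, which kills the
         product. *)
      rewrite (cup_const As (nth j As (fun _ => false)) (if b =? 0 then false else true)%nat).
      * apply andb_false_r.
      * apply nth_In. lia.
      * eapply Forall_impl; [|exact Hs]. intros y Hy. simpl in Hy.
        destruct (Nat.eqb_spec b 0) as [-> | Hb0]; [now apply Hj0|].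
        apply HjN. destruct Hb as [Hb | Hb]; [contradiction | congruence].
Qed.

Lemma cup_true (As : list (point -> bool)) : forall c A,
  cup As c = true -> In A As ->
  exists p q, In p c /\ In q c /\ A p = false /\ A q = true.
Proof.
  induction As as [|A' As IH]; intros c A Hc HA; [destruct HA|].
  destruct c as [|x [|y c]]; try discriminate.
  cbn [cup] in Hc. apply andb_prop in Hc. destruct Hc as [Hxy Hc].
  destruct HA as [-> | HA].
  - destruct (A x) eqn:Ex, (A y) eqn:Ey; try discriminate.
    + exists y, x. simpl; auto.
    + exists x, y. simpl; auto.
  - destruct (IH _ A Hc HA) as [p [q [Hp [Hq H]]]].
    exists p, q. simpl in *; tauto.
Qed.

Lemma cubical_sperner (N n : nat) (As : nat -> point -> bool) :
  (forall j, (j < n)%nat -> separates N j (As j)) ->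
  exists z, length z = n /\ Forall (fun a => (a < N)%nat) z /\
    forall j, (j < n)%nat -> exists p q,
      near_corner z p /\ near_corner z q /\ As j p = false /\ As j q = true.
Proof.
  intros H. set (l := map As (seq 0 n)).
  assert (Hl : length l = n) by (unfold l; now rewrite length_map, length_seq).
  assert (Hn : forall j, (j < n)%nat -> nth j l (fun _ => false) = As j).
  (* The default becomes [As O], the image of the default index 0, as [map_nth] requires. *)
  { intros j Hj. rewrite (nth_indep _ _ (As O)) by lia.
    unfold l. now rewrite map_nth, seq_nth. }
  assert (HS : cube_sum N n (cup l) = true).
  { rewrite <- Hl. apply cube_sum_cup. rewrite Hl. intros j Hj. rewrite Hn; auto. }
  apply NNPP. intros Hno.
  rewrite (cube_sum_ext N n (cup l) (fun _ => false)), cube_sum_false in HS; [discriminate|].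
  intros c [_ [z [Hz [HN Hc]]]].
  destruct (cup l c) eqn:E; auto. exfalso. apply Hno.
  exists z. repeat split; auto. intros j Hj.
  destruct (cup_true l c (As j) E) as [p [q [Hp [Hq HA]]]].
  { rewrite <- Hn by auto. apply nth_In. lia. }
  rewrite Forall_forall in Hc. exists p, q. auto.
Qed.

(** * Zeros of maps of a cube *)

(* Vectors of R^m are functions [nat -> R], of which only the values below [m] matter. *)
Definition cube (m : nat) (r : R) (c : nat -> R) : Prop :=
  forall i, (i < m)%nat -> Rabs (c i) <= r.

Definition close (m : nat) (delta : R) (c c' : nat -> R) : Prop :=
  forall i, (i < m)%nat -> Rabs (c i - c' i) < delta.

(** * Sequential compactness of the cube *)

Lemma choice (A B : Type) (R : A -> B -> Prop) :
  (forall x, exists y, R x y) -> exists f, forall x, R x (f x).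
Proof.
  intros H. exists (fun x => proj1_sig (constructive_indefinite_description _ (H x))).
  intros x. apply proj2_sig.
Qed.

Lemma inv_INR_S_pos (k : nat) : 0 < / INR (S k).
Proof. apply Rinv_0_lt_compat, lt_0_INR. lia. Qed.

Lemma inv_INR_S_small (eps : R) : 0 < eps ->
  exists K, forall k, (K <= k)%nat -> / INR (S k) < eps.
Proof.
  intros Heps. destruct (archimed_cor1 eps Heps) as [K [HK HK0]].
  exists K. intros k Hk. eapply Rle_lt_trans; [|exact HK].
  apply Rinv_le_contravar; [now apply lt_0_INR|]. apply le_INR. lia.
Qed.

Lemma Rabs_le_bounds (a b : R) : Rabs a <= b -> - b <= a <= b.
Proof. unfold Rabs. destruct (Rcase_abs a); lra. Qed.

Lemma bounded_seq_cv_subseq (x : nat -> R) (B : R) :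
  (forall k, Rabs (x k) <= B) ->
  exists (phi : nat -> nat) (l : R), (forall k, (k <= phi k)%nat) /\
    forall delta, 0 < delta ->
      exists K, forall k, (K <= k)%nat -> Rabs (x (phi k) - l) < delta.
Proof.
  intros H.
  destruct (Bolzano_Weierstrass x (fun c => - B <= c <= B)) as [l Hl].
  { apply compact_P3. }
  { intros k. specialize (H k). apply Rabs_le_bounds in H. lra. }
  destruct (choice _ _ (fun k p => (k <= p)%nat /\ Rabs (x p - l) < / INR (S k))) as [phi Hphi].
  { intros k. apply (Hl (fun y => Rabs (y - l) < / INR (S k))).
    exists (mkposreal _ (inv_INR_S_pos k)). intros y Hy. exact Hy. }
  exists phi, l. split; [apply Hphi|].
  intros delta Hd. destruct (inv_INR_S_small delta Hd) as [K HK].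
  exists K. intros k Hk. eapply Rlt_trans; [apply Hphi | auto].
Qed.

Lemma bounded_vec_cv_subseq (B : R) (m : nat) : forall x : nat -> nat -> R,
  (forall k, cube m B (x k)) ->
  exists (phi : nat -> nat) (l : nat -> R), (forall k, (k <= phi k)%nat) /\
    forall delta, 0 < delta ->
      exists K, forall k, (K <= k)%nat -> close m delta l (x (phi k)).
Proof.
  induction m as [|m IH]; intros x H.
  - exists (fun k => k), (fun _ => 0). split; auto.
    intros. exists O. intros k _ i Hi. lia.
  - destruct (IH x) as [phi [l [Hphi Hl]]].
    { intros k i Hi. apply H. lia. }
    destruct (bounded_seq_cv_subseq (fun k => x (phi k) m) B) as [psi [a [Hpsi Ha]]].
    { intros k. apply H. lia. }
    exists (fun k => phi (psi k)), (fun i => if (i =? m)%nat then a else l i). split.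
    { intros k. eapply Nat.le_trans; [apply Hpsi | apply Hphi]. }
    intros delta Hd. destruct (Hl _ Hd) as [K1 HK1]. destruct (Ha _ Hd) as [K2 HK2].
    exists (max K1 K2). intros k Hk i Hi.
    destruct (Nat.eqb_spec i m) as [-> | Him].
    + rewrite Rabs_minus_sym. apply HK2. lia.
    + apply HK1; [|lia]. specialize (Hpsi k). lia.
Qed.

Lemma cube_seq_cluster (m : nat) (r : R) (x : nat -> nat -> R) :
  (forall k, cube m r (x k)) ->
  exists l, cube m r l /\
    forall delta K, 0 < delta -> exists k, (K <= k)%nat /\ close m delta l (x k).
Proof.
  intros H. destruct (bounded_vec_cv_subseq r m x H) as [phi [l [Hphi Hl]]].
  assert (Hc : forall delta K, 0 < delta -> exists k, (K <= k)%nat /\ close m delta l (x k)).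
  { intros delta K Hd. destruct (Hl delta Hd) as [K' HK'].
    exists (phi (max K K')). split; [specialize (Hphi (max K K')); lia|].
    apply HK'. lia. }
  exists l. split; auto.
  (* If the limit left the closed cube, a term nearer to it than the excess would leave it too. *)
  intros i Hi. apply Rnot_lt_le. intros Hlt.
  destruct (Hc (Rabs (l i) - r) O) as [k [_ Hk]]; [lra|].
  specialize (Hk i Hi). specialize (H k i Hi).
  pose proof (Rabs_triang_inv (l i) (x k i)). lra.
Qed.

(** * Poincare-Miranda by refining grids *)

Definition grid_pt (N : nat) (r : R) (y : list nat) (i : nat) : R :=
  - r + 2 * r * (INR (nth i y O) / INR N).


Lemma grid_pt_cube (N : nat) (r : R) (y : list nat) (i : nat) :
  (0 < N)%nat -> 0 < r -> (nth i y O <= N)%nat -> Rabs (grid_pt N r y i) <= r.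
Proof.
  intros HN Hr Hy. unfold grid_pt.
  assert (HN' : 0 < INR N) by now apply lt_0_INR.
  assert (0 <= INR (nth i y O) / INR N <= 1).
  { split; [apply Rmult_le_pos; [apply pos_INR | now apply Rlt_le, Rinv_0_lt_compat]|].
    apply Rmult_le_reg_r with (INR N); auto. unfold Rdiv.
    rewrite Rmult_assoc, Rinv_l, Rmult_1_r, Rmult_1_l by lra. now apply le_INR. }
  apply Rabs_le. nra.
Qed.

Lemma grid_pt_near (N : nat) (r : R) (z p : list nat) (i : nat) :
  (0 < N)%nat -> 0 < r -> (nth i z O <= nth i p O <= S (nth i z O))%nat ->
  Rabs (grid_pt N r z i - grid_pt N r p i) <= 2 * r * / INR N.
Proof.
  intros HN Hr [H1 H2]. unfold grid_pt, Rdiv.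
  assert (HN' : 0 < / INR N) by now apply Rinv_0_lt_compat, lt_0_INR.
  apply le_INR in H1, H2. rewrite S_INR in H2.
  assert (0 <= (INR (nth i p O) - INR (nth i z O)) * / INR N <= / INR N) by nra.
  apply Rabs_le. nra.
Qed.

Lemma near_corner_nth (z p : list nat) (i : nat) :
  near_corner z p -> (i < length z)%nat ->
  (nth i z O <= nth i p O <= S (nth i z O))%nat.
Proof.
  intros H. revert i. induction H as [|a b z p Hab H IH]; simpl; intros i Hi; [lia|].
  destruct i; auto. apply IH. lia.
Qed.

(** On a lower face the i-th coordinate is [- r], so the displacement bound forces the i-th value of
    [f] to be at most 0; on an upper face it is at least 0. Labelling by signs thus meets the
    boundary conditions of the Sperner lemma. *)
Lemma grid_sign_change (m N : nat) (r : R) (f : (nat -> R) -> nat -> R) :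
  (0 < N)%nat -> 0 < r ->
  (forall c i, cube m r c -> (i < m)%nat -> Rabs (c i - f c i) <= r) ->
  exists c, cube m r c /\ forall i, (i < m)%nat -> exists p q,
    cube m r p /\ cube m r q /\
    (forall j, (j < m)%nat -> Rabs (c j - p j) <= 2 * r * / INR N) /\
    (forall j, (j < m)%nat -> Rabs (c j - q j) <= 2 * r * / INR N) /\
    f p i <= 0 /\ 0 <= f q i.
Proof.
  intros HN Hr Hf.
  (* Face labels are prescribed outright: on an upper face [f] may be 0 and fail the strict test,
     and [separates] also concerns lists outside the grid. *)
  set (A := fun i y => if (nth i y O =? 0)%nat then false
                       else if (nth i y O =? N)%nat then true
                       else if Rlt_dec 0 (f (grid_pt N r y) i) then true else false).
  destruct (cubical_sperner N m A) as [z [Hz [HzN Hsep]]].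
  { intros j Hj. split; intros y Hy; unfold A; rewrite Hy; auto.
    rewrite Nat.eqb_refl. destruct (Nat.eqb_spec N 0); auto. lia. }
  assert (HzN' : forall i, (i < m)%nat -> (nth i z O < N)%nat).
  { intros i Hi. rewrite Forall_forall in HzN. apply HzN, nth_In. lia. }
  assert (Hcube : forall p, near_corner z p -> cube m r (grid_pt N r p)).
  { intros p Hp i Hi. apply grid_pt_cube; auto.
    specialize (HzN' i Hi). apply (near_corner_nth z p i) in Hp; lia. }
  assert (Hnear : forall p, near_corner z p -> forall j, (j < m)%nat ->
            Rabs (grid_pt N r z j - grid_pt N r p j) <= 2 * r * / INR N).
  { intros p Hp j Hj. apply grid_pt_near; auto. apply near_corner_nth; auto. lia. }
  exists (grid_pt N r z). split.
  { intros i Hi. apply grid_pt_cube; auto. specialize (HzN' i Hi). lia. }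
  intros i Hi. destruct (Hsep i Hi) as [p [q [Hp [Hq [HAp HAq]]]]].
  exists (grid_pt N r p), (grid_pt N r q). repeat split; auto.
  - pose proof (Hf _ i (Hcube p Hp) Hi) as Hfp. apply Rabs_le_bounds in Hfp.
    unfold A in HAp. destruct (Nat.eqb_spec (nth i p O) 0) as [E|E].
    + assert (grid_pt N r p i = - r).
      { unfold grid_pt. rewrite E. simpl. unfold Rdiv. ring. }
      lra.
    + destruct (nth i p O =? N)%nat; [discriminate|].
      destruct (Rlt_dec 0 (f (grid_pt N r p) i)); [discriminate|lra].
  - pose proof (Hf _ i (Hcube q Hq) Hi) as Hfq. apply Rabs_le_bounds in Hfq.
    unfold A in HAq. destruct (nth i q O =? 0)%nat; [discriminate|].
    destruct (Nat.eqb_spec (nth i q O) N) as [E|E].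
    + assert (grid_pt N r q i = r).
      { unfold grid_pt. rewrite E. field. apply not_0_INR. lia. }
      lra.
    + destruct (Rlt_dec 0 (f (grid_pt N r q) i)); [lra|discriminate].
Qed.

(** As the mesh tends to 0, the cells cluster at a point that has, for each i, points arbitrarily
    near with i-th value at most 0 and others with it at least 0; continuity forces 0 there. *)
Lemma near_identity_has_zero (m : nat) (r : R) (f : (nat -> R) -> nat -> R) :
  0 < r ->
  (forall c i, cube m r c -> (i < m)%nat -> Rabs (c i - f c i) <= r) ->
  (forall c eps, cube m r c -> 0 < eps -> exists delta, 0 < delta /\
     forall c', cube m r c' -> close m delta c c' -> close m eps (f c) (f c')) ->
  exists c, cube m r c /\ forall i, (i < m)%nat -> f c i = 0.
Proof.
  intros Hr Hf Hcont.
  destruct (choice _ _ (fun N c => cube m r c /\ forall i, (i < m)%nat -> exists p q,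
    cube m r p /\ cube m r q /\
    (forall j, (j < m)%nat -> Rabs (c j - p j) <= 2 * r * / INR (S N)) /\
    (forall j, (j < m)%nat -> Rabs (c j - q j) <= 2 * r * / INR (S N)) /\
    f p i <= 0 /\ 0 <= f q i)) as [x Hx].
  { intros N. apply grid_sign_change; auto. lia. }
  destruct (cube_seq_cluster m r x (fun k => proj1 (Hx k))) as [l [Hl Hcl]].
  exists l. split; auto. intros i Hi. apply cond_eq. intros eps Heps.
  destruct (Hcont l eps Hl Heps) as [delta [Hd Hdelta]].
  (* This makes the mesh [2 * r / INR (S k)] less than [delta / 2]; the other half covers the
     distance from [l] to the cell. *)
  destruct (inv_INR_S_small (delta / (4 * r))) as [K HK].
  { apply Rdiv_lt_0_compat; lra. }
  destruct (Hcl (delta / 2) K) as [k [Hk Hlk]]; [lra|].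
  destruct (proj2 (Hx k) i Hi) as [p [q [Hp [Hq [Hxp [Hxq [Hfp Hfq]]]]]]].
  assert (Hmesh : 2 * r * / INR (S k) < delta / 2).
  { specialize (HK k Hk). apply Rmult_lt_compat_l with (r := 2 * r) in HK; [|lra].
    replace (2 * r * (delta / (4 * r))) with (delta / 2) in HK by (field; lra). exact HK. }
  assert (Hclose : forall p, (forall j, (j < m)%nat -> Rabs (x k j - p j) <= 2 * r * / INR (S k)) ->
            close m delta l p).
  { intros p' Hp' j Hj. specialize (Hp' j Hj). specialize (Hlk j Hj).
    replace (l j - p' j) with ((l j - x k j) + (x k j - p' j)) by ring.
    pose proof (Rabs_triang (l j - x k j) (x k j - p' j)). lra. }
  pose proof (Hdelta p Hp (Hclose p Hxp) i Hi) as Ep.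
  pose proof (Hdelta q Hq (Hclose q Hxq) i Hi) as Eq.
  apply Rabs_def2 in Ep, Eq. apply Rabs_def1; lra.
Qed.

(** * Finite-dimensional subspaces *)

Section VectorSpace.
Variable X : VecSpace.

Local Notation "x +v y" := (vadd X x y) (at level 50, left associativity).
Local Notation "a *v x" := (vscal X a x) (at level 40).
Local Notation "-v x" := (vopp X x) (at level 35).
Local Notation "0v" := (vzero X).

Lemma vadd0r (x : X) : x +v 0v = x.
Proof. rewrite vaddC. apply vadd0. Qed.

Lemma vaddNr (x : X) : x +v -v x = 0v.
Proof. rewrite vaddC. apply vaddN. Qed.

Lemma vadd_cancel_l (x y z : X) : x +v y = x +v z -> y = z.
Proof.
  intros H. rewrite <- (vadd0 X y), <- (vadd0 X z), <- (vaddN X x), <- !vaddA. now rewrite H.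
Qed.

Lemma vaddACA (a b c e : X) : (a +v b) +v (c +v e) = (a +v c) +v (b +v e).
Proof.
  rewrite <- !vaddA. f_equal. rewrite !vaddA. f_equal. apply vaddC.
Qed.

Lemma vscal0l (x : X) : 0 *v x = 0v.
Proof.
  apply (vadd_cancel_l (0 *v x)). rewrite <- vscalDl, vadd0r. now rewrite Rplus_0_r.
Qed.

Lemma vscal0r (a : R) : a *v 0v = 0v.
Proof.
  apply (vadd_cancel_l (a *v 0v)). now rewrite <- vscalDr, !vadd0r.
Qed.

Lemma vopp_scal (x : X) : -v x = (-1) *v x.
Proof.
  apply (vadd_cancel_l x). rewrite vaddNr.
  rewrite <- (vscal1 X x) at 1. rewrite <- vscalDl.
  replace (1 + -1) with 0 by ring. now rewrite vscal0l.
Qed.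

Lemma vsub_eq0 (x y : X) : x +v -v y = 0v -> x = y.
Proof.
  intros H. apply (vadd_cancel_l (-v y)). now rewrite (vaddC X _ x), H, vaddN.
Qed.

Lemma lincomb_ext (m : nat) (c c' : nat -> R) (e e' : nat -> X) :
  (forall i, (i < m)%nat -> c i = c' i /\ e i = e' i) ->
  lincomb X m c e = lincomb X m c' e'.
Proof.
  induction m as [|m IH]; intros H; simpl; auto.
  destruct (H m) as [-> ->]; auto. rewrite IH; auto.
Qed.

Lemma lincomb_add (m : nat) (c c' : nat -> R) (e : nat -> X) :
  lincomb X m c e +v lincomb X m c' e = lincomb X m (fun i => c i + c' i) e.
Proof.
  induction m as [|m IH]; simpl; [apply vadd0|].
  now rewrite vscalDl, <- IH, vaddACA.
Qed.

Lemma lincomb_scal (m : nat) (a : R) (c : nat -> R) (e : nat -> X) :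
  a *v lincomb X m c e = lincomb X m (fun i => a * c i) e.
Proof.
  induction m as [|m IH]; simpl; [apply vscal0r|].
  now rewrite vscalDr, IH, vscalA.
Qed.

Lemma lincomb_sub (m : nat) (c c' : nat -> R) (e : nat -> X) :
  lincomb X m c e +v -v lincomb X m c' e = lincomb X m (fun i => c i - c' i) e.
Proof.
  rewrite vopp_scal, lincomb_scal, lincomb_add. apply lincomb_ext.
  intros i _. split; auto. ring.
Qed.

Lemma lincomb_zero (m : nat) (c : nat -> R) (e : nat -> X) :
  (forall i, (i < m)%nat -> c i = 0) -> lincomb X m c e = 0v.
Proof.
  intros H. rewrite <- (vscal0l (lincomb X m c e)), lincomb_scal.
  apply lincomb_ext. intros i Hi. rewrite (H i Hi). split; auto. ring.
Qed.

Definition free_family (m : nat) (e : nat -> X) : Prop :=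
  forall c, lincomb X m c e = 0v -> forall i, (i < m)%nat -> c i = 0.

Lemma free_family_snoc (m : nat) (e : nat -> X) :
  free_family m e -> (forall b, e m <> lincomb X m b e) -> free_family (S m) e.
Proof.
  intros He Hm c Hc. simpl in Hc.
  assert (Hcm : c m = 0).
  (* A nonzero last coefficient would allow solving for [e m]. *)
  { apply NNPP. intros Hne. apply (Hm (fun i => - / c m * c i)).
    rewrite <- lincomb_scal.
    assert (E : (- / c m) *v (lincomb X m c e +v c m *v e m) = 0v)
      by (rewrite Hc; apply vscal0r).
    rewrite vscalDr, vscalA in E.
    replace (- / c m * c m) with (-1) in E by now field.
    rewrite <- vopp_scal in E. symmetry. now apply vsub_eq0. }
  rewrite Hcm, vscal0l, vadd0r in Hc.
  intros i Hi. destruct (Nat.eq_dec i m) as [-> | Him]; auto.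
  apply (He c Hc). lia.
Qed.

(** Greedy choice: a vector is kept only when it is outside the span of those kept before. [P] will
    be membership in the range of the projection. *)
Lemma extract_free_family (P : X -> Prop) (n : nat) (e : nat -> X) :
  (forall i, P (e i)) ->
  exists m e', free_family m e' /\ (forall i, P (e' i)) /\
    forall c, exists c', lincomb X n c e = lincomb X m c' e'.
Proof.
  intros HP. induction n as [|n [m [e' [Hfree [HP' Hspan]]]]].
  - exists O, e. repeat split; auto.
    + intros c _ i Hi. lia.
    + intros c. exists c. reflexivity.
  - destruct (classic (exists b, e n = lincomb X m b e')) as [[b Hb] | Hb].
    + exists m, e'. repeat split; auto. intros c. destruct (Hspan c) as [c' Hc'].
      exists (fun i => c' i + c n * b i). simpl.
      now rewrite Hc', Hb, <- lincomb_add, <- lincomb_scal.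
    + set (e'' := fun i => if (i =? m)%nat then e n else e' i).
      assert (Hm : e'' m = e n) by (unfold e''; now rewrite Nat.eqb_refl).
      assert (Hlt : forall i, (i < m)%nat -> e'' i = e' i).
      { intros i Hi. unfold e''. destruct (Nat.eqb_spec i m); auto. lia. }
      assert (Hcomb : forall c, lincomb X m c e'' = lincomb X m c e')
        by (intros c; apply lincomb_ext; auto).
      exists (S m), e''. repeat split.
      * apply free_family_snoc.
        -- intros c. rewrite Hcomb. apply Hfree.
        -- intros c Hc. rewrite Hcomb, Hm in Hc. eauto.
      * intros i. unfold e''. destruct (i =? m)%nat; auto.
      * intros c. destruct (Hspan c) as [c' Hc'].
        exists (fun i => if (i =? m)%nat then c n else c' i). simpl.
        rewrite Nat.eqb_refl, Hm. f_equal. rewrite Hc'. apply lincomb_ext.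
        intros i Hi. destruct (Nat.eqb_spec i m); [lia|]. split; auto. now rewrite Hlt.
Qed.

End VectorSpace.

Fixpoint max_abs (m : nat) (c : nat -> R) : R :=
  match m with
  | O => 0
  | S k => Rmax (max_abs k c) (Rabs (c k))
  end.

Lemma max_abs_ge (m : nat) (c : nat -> R) : cube m (max_abs m c) c.
Proof.
  induction m as [|m IH]; intros i Hi; [lia|]. simpl.
  destruct (Nat.eq_dec i m) as [-> | Him]; [apply Rmax_r|].
  eapply Rle_trans; [|apply Rmax_l]. apply IH. lia.
Qed.

Lemma max_abs_le (m : nat) (B : R) (c : nat -> R) : 0 <= B -> cube m B c -> max_abs m c <= B.
Proof.
  intros HB H. induction m as [|m IH]; simpl; auto.
  apply Rmax_lub; [apply IH; intros i Hi; apply H; lia | apply H; lia].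
Qed.

Lemma max_abs_scal (m : nat) (a : R) (c : nat -> R) :
  max_abs m (fun i => a * c i) = Rabs a * max_abs m c.
Proof.
  induction m as [|m IH]; simpl; [ring|].
  rewrite IH, Rabs_mult. apply RmaxRmult, Rabs_pos.
Qed.

(** * Continuity of linear combinations and of their coordinates *)

Section FrechetSpace.
Variable X : VecSpace.
Variable d : X -> X -> R.
Hypothesis HX : frechet_metric X d.
Hypothesis Hti : translation_invariant X d.

Local Notation "x +v y" := (vadd X x y) (at level 50, left associativity).
Local Notation "a *v x" := (vscal X a x) (at level 40).
Local Notation "-v x" := (vopp X x) (at level 35).
Local Notation "0v" := (vzero X).

Lemma fdist_refl (x : X) : d x x = 0.
Proof. destruct HX as [[_ [H _]] _]. now apply H. Qed.

Lemma fdist_sym (x y : X) : d x y = d y x.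
Proof. destruct HX as [[_ [_ [H _]]] _]. apply H. Qed.

Lemma fdist_triangle (x y z : X) : d x z <= d x y + d y z.
Proof. destruct HX as [[_ [_ [_ H]]] _]. apply H. Qed.

Lemma fdist_add_l (w x y : X) : d (w +v x) (w +v y) = d x y.
Proof. rewrite !(vaddC X w). symmetry. apply Hti. Qed.

Lemma fdist_sub (x y : X) : d x y = d 0v (y +v -v x).
Proof. rewrite (Hti x y (-v x)). now rewrite vaddNr. Qed.

Lemma fdist_add (x y x' y' : X) : d (x +v y) (x' +v y') <= d x x' + d y y'.
Proof.
  eapply Rle_trans; [apply (fdist_triangle _ (x' +v y))|].
  rewrite <- Hti, fdist_add_l. lra.
Qed.

Lemma lincomb_continuous (m : nat) (e : nat -> X) (c : nat -> R) : forall eps, 0 < eps ->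
  exists delta, 0 < delta /\
    forall c', close m delta c c' -> d (lincomb X m c e) (lincomb X m c' e) < eps.
Proof.
  induction m as [|m IH]; intros eps Heps.
  - exists 1. split; [lra|]. intros c' _. simpl. now rewrite fdist_refl.
  - destruct (IH (eps / 2)) as [d1 [Hd1 H1]]; [lra|].
    destruct HX as [_ [_ [Hscal _]]].
    destruct (Hscal (c m) (e m) (eps / 2)) as [d2 [Hd2 H2]]; [lra|].
    exists (Rmin d1 d2). split; [now apply Rmin_glb_lt|].
    intros c' Hc'. simpl. eapply Rle_lt_trans; [apply fdist_add|].
    assert (d (lincomb X m c e) (lincomb X m c' e) < eps / 2).
    { apply H1. intros i Hi. eapply Rlt_le_trans; [apply Hc'; lia | apply Rmin_l]. }
    assert (d (c m *v e m) (c' m *v e m) < eps / 2).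
    { apply H2; [|now rewrite fdist_refl].
      eapply Rlt_le_trans; [apply Hc'; lia | apply Rmin_r]. }
    lra.
Qed.

(* Local convexity makes small scalings equicontinuous at the origin. *)
Lemma bounded_scal_small (b eps : R) : 0 < b -> 0 < eps ->
  exists delta, 0 < delta /\
    forall a x, 0 <= a <= b -> d 0v x < delta -> d 0v (a *v x) < eps.
Proof.
  intros Hb Heps. destruct HX as [_ [_ [Hscal [_ Hconv]]]].
  destruct (Hconv eps Heps) as [C [HC [[d1 [Hd1 Hin]] Hout]]].
  destruct (Hscal b 0v d1 Hd1) as [d2 [Hd2 H2]].
  exists d2. split; auto. intros a x Ha Hx. apply Hout.
  (* The vector [a *v x] lies on the segment from 0 to [b *v x], both in the convex set [C]. *)
  replace (a *v x) with ((a / b) *v (b *v x) +v (1 - a / b) *v 0v).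
  - apply HC.
    + apply Hin. rewrite <- (vscal0r X b). apply H2; auto.
      rewrite Rminus_diag, Rabs_R0. lra.
    + apply Hin. now rewrite fdist_refl.
    + split; [apply Rmult_le_pos; [lra|]; now apply Rlt_le, Rinv_0_lt_compat|].
      apply Rmult_le_reg_r with b; auto. unfold Rdiv.
      rewrite Rmult_assoc, Rinv_l; lra.
  - rewrite vscal0r, vadd0r, vscalA. f_equal. field. lra.
Qed.

(** Compactness: otherwise coefficient vectors of sup norm 1 with combinations tending to 0 would
    cluster at some [l] whose combination is 0. Freeness gives [l = 0], too far from the unit
    sphere. *)
Lemma free_family_sphere (m : nat) (e : nat -> X) : free_family X m e ->
  exists eta, 0 < eta /\
    forall c, max_abs m c = 1 -> eta <= d 0v (lincomb X m c e).
Proof.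
  intros He. apply NNPP. intros Hno.
  destruct (choice _ _ (fun k c => max_abs m c = 1 /\ d 0v (lincomb X m c e) < / INR (S k)))
    as [x Hx].
  { intros k. apply NNPP. intros Hk. apply Hno. exists (/ INR (S k)).
    split; [apply inv_INR_S_pos|]. intros c Hc. apply Rnot_lt_le. intros Hlt. eauto. }
  destruct (cube_seq_cluster m 1 x) as [l [_ Hl]].
  { intros k. destruct (Hx k) as [<- _]. apply max_abs_ge. }
  assert (Hzero : lincomb X m l e = 0v).
  { destruct HX as [[Hpos [Hsep _]] _]. symmetry. apply Hsep.
    apply cond_eq. intros eps Heps. rewrite Rminus_0_r, Rabs_right by (apply Rle_ge, Hpos).
    destruct (lincomb_continuous m e l (eps / 2)) as [delta [Hd Hdelta]]; [lra|].
    destruct (inv_INR_S_small (eps / 2)) as [K HK]; [lra|].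
    destruct (Hl delta K Hd) as [k [Hk Hlk]].
    specialize (Hdelta _ Hlk). specialize (HK k Hk). destruct (Hx k) as [_ Hxk].
    pose proof (fdist_triangle 0v (lincomb X m (x k) e) (lincomb X m l e)).
    rewrite fdist_sym in Hdelta. lra. }
  destruct (Hl (1 / 2) O) as [k [_ Hk]]; [lra|].
  destruct (Hx k) as [H1 _].
  assert (max_abs m (x k) <= 1 / 2); [|lra].
  apply max_abs_le; [lra|]. intros i Hi. specialize (Hk i Hi).
  rewrite (He l Hzero i Hi), Rminus_0_l, Rabs_Ropp in Hk. lra.
Qed.

(** The metric is not homogeneous, so normalising needs [bounded_scal_small]: if some coordinate
    reached [r], dividing by the sup norm [M >= r] would scale by at most [/ r], keeping the vector
    small yet on the unit sphere. *)
Lemma free_family_coord_small (m : nat) (e : nat -> X) (r : R) :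
  free_family X m e -> 0 < r ->
  exists eta, 0 < eta /\
    forall c, d 0v (lincomb X m c e) < eta -> forall i, (i < m)%nat -> Rabs (c i) < r.
Proof.
  intros He Hr.
  destruct (free_family_sphere m e He) as [eta [Heta Hsphere]].
  destruct (bounded_scal_small (/ r) eta) as [delta [Hd Hdelta]]; auto.
  { now apply Rinv_0_lt_compat. }
  exists delta. split; auto. intros c Hc i Hi. apply Rnot_le_lt. intros Hri.
  set (M := max_abs m c).
  assert (HM : r <= M) by (eapply Rle_trans; [exact Hri | now apply max_abs_ge]).
  assert (HM' : 0 < / M) by (apply Rinv_0_lt_compat; lra).
  assert (HlM : eta <= d 0v (lincomb X m (fun i => / M * c i) e)).
  { apply Hsphere. rewrite max_abs_scal, Rabs_right by lra. fold M. field. lra. }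
  rewrite <- lincomb_scal in HlM.
  assert (d 0v (/ M *v lincomb X m c e) < eta); [|lra].
  apply Hdelta; auto. split; [lra|]. apply Rinv_le_contravar; lra.
Qed.

End FrechetSpace.

(** * Steering *)

Lemma lsg_comp_app (X : VecSpace) (l l' : list (LSG X * R)) : forall x,
  lsg_comp (l ++ l') x =
  match lsg_comp l x with Some y => lsg_comp l' y | None => None end.
Proof.
  induction l as [|[Psi t] l IH]; intros x; simpl; auto.
  destruct (Psi t x); auto.
Qed.

Lemma sum_times_app (A : Type) (l l' : list (A * R)) :
  sum_times (l ++ l') = sum_times l + sum_times l'.
Proof.
  induction l as [|a l IH]; simpl; [ring|].
  unfold sum_times in *. rewrite IH. ring.
Qed.

Section Families.
Variables (X : VecSpace) (d : X -> X -> R) (Y : Type) (dY : Y -> Y -> R).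

Lemma sum_times_inst (l : list ((LSFamily X d dY * (X -> Y)) * R)) (x : X) :
  sum_times (inst l x) = sum_times l.
Proof.
  induction l as [|a l IH]; simpl; auto. unfold sum_times in *. now rewrite IH.
Qed.

Lemma inD_inst (F : LSFamily X d dY -> Prop) (B : X -> Prop)
  (l : list ((LSFamily X d dY * (X -> Y)) * R)) (x : X) :
  B x ->
  Forall (fun a => F (fst (fst a)) /\ 0 < snd a /\
            (forall x, B x -> lsP (fst (fst a)) (snd (fst a) x)) /\
            cont_on X d dY B (snd (fst a))) l ->
  Forall (fun a => inD F (fst a) /\ 0 < snd a) (inst l x).
Proof.
  intros Hx Hl. apply Forall_map. eapply Forall_impl; [|exact Hl].
  intros [[Phi g] s] [HF [Hs [HP _]]]. simpl in *. split; auto.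
  exists Phi, (g x). auto.
Qed.

(** Joint continuity in the steering target and the starting point, including survival of nearby
    trajectories: axiom (iii) of each family is chained backwards from the last step. *)
Lemma lsg_comp_inst_continuous (F : LSFamily X d dY -> Prop) (B : X -> Prop)
  (l : list ((LSFamily X d dY * (X -> Y)) * R)) :
  Forall (fun a => F (fst (fst a)) /\ 0 < snd a /\
            (forall x, B x -> lsP (fst (fst a)) (snd (fst a) x)) /\
            cont_on X d dY B (snd (fst a))) l ->
  forall x u w, B x -> lsg_comp (inst l x) u = Some w ->
  forall eps, 0 < eps -> exists delta, 0 < delta /\
    forall x' u', B x' -> d x x' < delta -> d u u' < delta ->
      exists w', lsg_comp (inst l x') u' = Some w' /\ d w w' < eps.
Proof.
  induction 1 as [|[[Phi g] s] l [_ [Hs [HP Hg]]] Hl IH];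
    intros x u w Hx Hw eps Heps; simpl in *.
  - injection Hw as <-. exists eps. split; auto. intros x' u' _ _ Hu. eauto.
  - destruct (lsphi Phi s u (g x)) as [y|] eqn:Ey; [|discriminate].
    destruct (IH x y w Hx Hw eps Heps) as [d1 [Hd1 H1]].
    destruct (lsH Phi) as [_ Hphi].
    destruct (Hphi u (g x) (HP x Hx)) as [_ [_ [_ Hcont]]].
    destruct (Hcont s y (Rlt_le _ _ Hs) Ey d1 Hd1) as [d2 [Hd2 H2]].
    destruct (Hg x Hx (d2 / 2)) as [d3 [Hd3 H3]]; [lra|].
    exists (Rmin d1 (Rmin (d2 / 2) d3)). split.
    { repeat apply Rmin_glb_lt; lra. }
    intros x' u' Hx' Hxx' Huu'.
    pose proof (Rmin_l d1 (Rmin (d2 / 2) d3)). pose proof (Rmin_r d1 (Rmin (d2 / 2) d3)).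
    pose proof (Rmin_l (d2 / 2) d3). pose proof (Rmin_r (d2 / 2) d3).
    destruct (H2 s u' (g x')) as [y' [Ey' Hy']].
    + lra.
    + auto.
    + rewrite Rminus_diag, Rabs_R0.
      assert (dY (g x) (g x') < d2 / 2) by (apply H3; auto; lra). lra.
    + rewrite Ey'. apply H1; auto. lra.
Qed.

End Families.

(** Continuity at [ut] gives a radius depending on the target; compactness of the coefficient cube
    makes it uniform, since bad pairs would cluster at some [(ut, c)]. *)
Lemma steering_uniform_on_cube (X : VecSpace) (d : X -> X -> R)
  (HX : frechet_metric X d) (Hti : translation_invariant X d)
  (Y : Type) (dY : Y -> Y -> R) (F : LSFamily X d dY -> Prop) (B : X -> Prop)
  (l : list ((LSFamily X d dY * (X -> Y)) * R))
  (Hl : Forall (fun a => F (fst (fst a)) /\ 0 < snd a /\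
            (forall x, B x -> lsP (fst (fst a)) (snd (fst a) x)) /\
            cont_on X d dY B (snd (fst a))) l)
  (m : nat) (e : nat -> X) (r : R) (v ut : X) (C eps : R) :
  C < eps ->
  (forall c, cube m r c -> B (vadd X v (lincomb X m c e))) ->
  (forall x, B x -> exists w, lsg_comp (inst l x) ut = Some w /\ d w x <= C) ->
  exists delta, 0 < delta /\ forall u' c, d u' ut < delta -> cube m r c ->
    exists w, lsg_comp (inst l (vadd X v (lincomb X m c e))) u' = Some w /\
      d w (vadd X v (lincomb X m c e)) < eps.
Proof.
  intros HC HB Hend. apply NNPP. intros Hno.
  destruct (choice _ _ (fun k (p : X * (nat -> R)) => d (fst p) ut < / INR (S k) /\
    cube m r (snd p) /\
    ~ exists w, lsg_comp (inst l (vadd X v (lincomb X m (snd p) e))) (fst p) = Some w /\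
        d w (vadd X v (lincomb X m (snd p) e)) < eps)) as [x Hx].
  { intros k. apply NNPP. intros Hk. apply Hno. exists (/ INR (S k)).
    split; [apply inv_INR_S_pos|]. intros u' c Hu' Hc.
    apply NNPP. intros Hw. apply Hk. exists (u', c). auto. }
  destruct (cube_seq_cluster m r (fun k => snd (x k))) as [c [Hc Hcl]].
  { intros k. apply Hx. }
  set (E := fun c => vadd X v (lincomb X m c e)) in *.
  destruct (Hend (E c) (HB c Hc)) as [w [Hw Hwd]].
  (* The slack [eps - C] is split between moving the endpoint and moving the target. *)
  destruct (lsg_comp_inst_continuous X d Y dY F B l Hl (E c) ut w (HB c Hc) Hw ((eps - C) / 2))
    as [d1 [Hd1 H1]]; [lra|].
  destruct (lincomb_continuous X d HX Hti m e c (Rmin d1 ((eps - C) / 2))) as [d2 [Hd2 H2]].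
  { apply Rmin_glb_lt; lra. }
  destruct (inv_INR_S_small d1 Hd1) as [K HK].
  destruct (Hcl d2 K Hd2) as [k [Hk Hck]]. specialize (HK k Hk).
  destruct (Hx k) as [Huk [Hck' Hbad]].
  assert (HE : d (E c) (E (snd (x k))) < Rmin d1 ((eps - C) / 2)).
  { unfold E. rewrite (fdist_add_l X d Hti). now apply H2. }
  pose proof (Rmin_l d1 ((eps - C) / 2)). pose proof (Rmin_r d1 ((eps - C) / 2)).
  destruct (H1 (E (snd (x k))) (fst (x k))) as [w' [Hw' Hww']].
  - now apply HB.
  - lra.
  - rewrite (fdist_sym X d HX). lra.
  - apply Hbad. exists w'. split; auto.
    pose proof (fdist_triangle X d HX w' w (E (snd (x k)))).
    pose proof (fdist_triangle X d HX w (E c) (E (snd (x k)))).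
    rewrite (fdist_sym X d HX w w') in Hww'. fold (E (snd (x k))). lra.
Qed.

Lemma proj_lincomb (X : VecSpace) (d : X -> X -> R) (pi : X -> X)
  (Hpi : cont_lin_proj_findim X d pi) (m : nat) (c : nat -> R) (e : nat -> X) :
  pi (lincomb X m c e) = lincomb X m c (fun i => pi (e i)).
Proof.
  destruct Hpi as [Hadd [Hscal _]].
  induction m as [|m IH]; simpl.
  - apply (vadd_cancel_l X (pi (vzero X))). now rewrite <- Hadd, !vadd0r.
  - now rewrite Hadd, Hscal, IH.
Qed.

Lemma range_basis (X : VecSpace) (d : X -> X -> R) (pi : X -> X)
  (Hpi : cont_lin_proj_findim X d pi) :
  exists m e, free_family X m e /\ (forall i, pi (e i) = e i) /\
    forall x, exists c, pi x = lincomb X m c e.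
Proof.
  pose proof Hpi as [_ [_ [_ [Hidem [n [e He]]]]]].
  destruct (extract_free_family X (fun x => pi x = x) n (fun i => pi (e i)))
    as [m [e' [Hfree [Hfix Hspan]]]]; [auto|].
  exists m, e'. repeat split; auto. intros x.
  destruct (He x) as [c Hc]. destruct (Hspan c) as [c' Hc']. exists c'.
  (* By idempotence, [pi x] is [pi] of a combination of the [e i], hence a combination of the
     [pi (e i)]. *)
  now rewrite <- Hc', <- (proj_lincomb X d pi Hpi), <- Hc, Hidem.
Qed.

Theorem theorem3p11
  (X : VecSpace) (d : X -> X -> R)
  (HX : frechet_metric X d) (Hti : translation_invariant X d)
  (Y : Type) (dY : Y -> Y -> R) (HY : is_metric dY)
  (F : LSFamily X d dY -> Prop)
  (pi : X -> X) (Hpi : cont_lin_proj_findim X d pi)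
  (H1 : approx_controllable F)
  (H2 : forall (v : X) (eps eps' t : R), 0 < eps -> 0 < eps' -> 0 < t ->
     exists (ut : X) (l : list ((LSFamily X d dY * (X -> Y)) * R)),
       l <> nil /\
       Forall (fun a =>
                 F (fst (fst a)) /\ 0 < snd a /\
                 (forall x, Bpi X d pi v eps x -> lsP (fst (fst a)) (snd (fst a) x)) /\
                 cont_on X d dY (Bpi X d pi v eps) (snd (fst a))) l /\
       sum_times l <= t /\
       exists c, c < eps' /\
         forall vt, Bpi X d pi v eps vt ->
           exists w, lsg_comp (inst l vt) ut = Some w /\ d w vt <= c) :
  forall (u v : X) (t eps : R), 0 < t -> 0 < eps ->
    exists l : list (LSG X * R),
      Forall (fun a => inD F (fst a) /\ 0 < snd a) l /\
      sum_times l = t /\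
      exists w, lsg_comp l u = Some w /\ pi w = pi v /\ d w v < eps.
Proof.
  intros u v t eps Ht Heps.
  destruct (range_basis X d pi Hpi) as [m [e [Hfree [Hfix Hspan]]]].
  pose proof Hpi as [Hadd [Hscal [Hcont _]]].
  assert (Hsub : forall x y, pi (vadd X x (vopp X y)) = vadd X (pi x) (vopp X (pi y))).
  { intros x y. now rewrite Hadd, !vopp_scal, Hscal. }
  set (L := fun c => lincomb X m c e).
  assert (HpiL : forall c, pi (L c) = L c).
  { intros c. unfold L. rewrite (proj_lincomb X d pi Hpi). apply lincomb_ext. auto. }
  assert (HL0 : forall c, (forall i, (i < m)%nat -> c i = 0) -> L c = vzero X)
    by (intros c; apply lincomb_zero).
  assert (Hcoord : forall r, 0 < r -> exists eta, 0 < eta /\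
    forall c c', d (L c) (L c') < eta -> close m r c' c).
  { intros r Hr. destruct (free_family_coord_small X d HX Hti m e r Hfree Hr) as [eta [He Heta]].
    exists eta. split; auto. intros c c' Hcc'.
    rewrite (fdist_sub X d Hti) in Hcc'. unfold L in Hcc'. rewrite lincomb_sub in Hcc'.
    exact (Heta _ Hcc'). }
  destruct (lincomb_continuous X d HX Hti m e (fun _ => 0) (eps / 2)) as [r0 [Hr0 Hr0L]]; [lra|].
  (* Halving passes from the strict bound of [close] to the closed cube. *)
  set (r := r0 / 2).
  assert (Hr : 0 < r) by (unfold r; lra).
  assert (HrL : forall c, cube m r c -> d (vzero X) (L c) < eps / 2).
  { intros c Hc. rewrite <- (HL0 (fun _ => 0)) by auto. apply Hr0L.
    intros i Hi. rewrite Rminus_0_l, Rabs_Ropp. specialize (Hc i Hi). unfold r in Hc. lra. }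
  destruct (Hcoord r Hr) as [eta [Heta Hclose]].
  destruct (Hcont (vzero X) eta Heta) as [eps2 [Heps2 Hpi_small]].
  (* An error below [eps2] keeps the projected displacement below [eta], hence its coordinates below
     [r]; an error below [eps / 2] serves the final distance bound. Time [t / 2] leaves a positive
     remainder for the approach to [ut]. *)
  destruct (H2 v (eps / 2) (Rmin eps2 (eps / 2)) (t / 2))
    as [ut [l [_ [Hl [Hlt [C [HC Hend]]]]]]]; [lra | apply Rmin_glb_lt; lra | lra |].
  set (B := Bpi X d pi v (eps / 2)) in *.
  assert (HB : forall c, cube m r c -> B (vadd X v (L c))).
  { intros c Hc. exists (L c). repeat split.
    - exists (L c). auto.
    - now apply Rlt_le, HrL. }
  destruct (steering_uniform_on_cube X d HX Hti Y dY F B l Hl m e r v ut C _ HC HB Hend)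
    as [delta [Hdelta Hsteer]].
  destruct (H1 u (t - sum_times l)) with (x := ut) (eps := delta)
    as [u' [[l0 [Hl0 [Hl0t Hl0u]]] Hu']]; [lra | auto |].
  set (E := fun c => vadd X v (L c)).
  (* [f c] pairs the endpoint reached when aiming at [E c] with the coordinates of its projected
     offset from [v]; off the cube the value is a dummy. *)
  assert (Hf : forall c, exists p : X * (nat -> R), cube m r c ->
     lsg_comp (inst l (E c)) u' = Some (fst p) /\ d (fst p) (E c) < Rmin eps2 (eps / 2) /\
     vadd X (pi (fst p)) (vopp X (pi v)) = L (snd p)).
  { intros c. destruct (classic (cube m r c)) as [Hc | Hc].
    - destruct (Hsteer u' c Hu' Hc) as [w [Hw Hwd]].
      destruct (Hspan (vadd X w (vopp X v))) as [a Ha].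
      exists (w, a). intros _. repeat split; auto. now rewrite <- Hsub.
    - exists (u, c). contradiction. }
  apply choice in Hf. destruct Hf as [f Hf].
  destruct (near_identity_has_zero m r (fun c => snd (f c)) Hr) as [c [Hc Hzero]].
  - intros c i Hc Hi. destruct (Hf c Hc) as [_ [Hd Hs]].
    apply Rlt_le. revert i Hi. apply (Hclose (snd (f c)) c).
    rewrite <- Hs, (fdist_sub X d Hti).
    (* Since [pi] fixes [L c], the difference is the projection of the steering error
       [E c - fst (f c)]. *)
    replace (vadd X (L c) (vopp X (vadd X (pi (fst (f c))) (vopp X (pi v)))))
      with (pi (vadd X (E c) (vopp X (fst (f c))))).
    + rewrite <- (HL0 (fun _ => 0)), <- HpiL, HL0 by auto.
      apply Hpi_small. rewrite <- (fdist_sub X d Hti).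
      eapply Rlt_le_trans; [exact Hd | apply Rmin_l].
    + rewrite Hsub. unfold E. rewrite Hadd, HpiL, !vopp_scal, vscalDr, vscalA.
      replace (-1 * -1) with 1 by ring. rewrite vscal1.
      rewrite (vaddC X (pi v)), <- !vaddA. f_equal. apply vaddC.
  - intros c eps3 Hc Heps3. destruct (Hf c Hc) as [Hw [_ Hs]].
    (* Continuity of the coordinates is pulled back through the coordinate map, [pi], the flow
       composition and [L], in that order. *)
    destruct (Hcoord eps3 Heps3) as [eta3 [Heta3 Hclose3]].
    destruct (Hcont (fst (f c)) eta3 Heta3) as [d1 [Hd1 Hpi1]].
    destruct (lsg_comp_inst_continuous X d Y dY F B l Hl (E c) u' _ (HB c Hc) Hw d1 Hd1)
      as [d2 [Hd2 Hcomp]].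
    destruct (lincomb_continuous X d HX Hti m e c d2 Hd2) as [d3 [Hd3 HL3]].
    exists d3. split; auto. intros c' Hc' Hcc'.
    destruct (Hf c' Hc') as [Hw' [_ Hs']].
    apply Hclose3. rewrite <- Hs, <- Hs', <- Hti, (fdist_sym X d HX). apply Hpi1.
    destruct (Hcomp (E c') u') as [w' [Ew' Hww']].
    + now apply HB.
    + unfold E. rewrite (fdist_add_l X d Hti). now apply HL3.
    + now rewrite (fdist_refl X d HX).
    + rewrite Hw' in Ew'. injection Ew' as <-. exact Hww'.
  - destruct (Hf c Hc) as [Hw [Hd Hs]].
    exists (l0 ++ inst l (E c)). split; [|split].
    + apply Forall_app. split; auto.
      apply (inD_inst X d Y dY F B); auto. now apply HB.
    + rewrite sum_times_app, sum_times_inst, Hl0t. ring.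
    + exists (fst (f c)). split; [|split].
      * now rewrite lsg_comp_app, Hl0u.
      * apply vsub_eq0. rewrite Hs. now apply HL0.
      * pose proof (fdist_triangle X d HX (fst (f c)) (E c) v) as Htri.
        assert (HEv : d (E c) v < eps / 2).
        { unfold E. rewrite (fdist_sym X d HX), <- (vadd0r X v) at 1.
          rewrite (fdist_add_l X d Hti). now apply HrL. }
        pose proof (Rmin_r eps2 (eps / 2)). lra.
Qed.
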